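(* Let $S\subset\mathbb{R}$ be a bounded set with at least two elements, and let $\operatorname{diam}(S)=\sup_{s,s'\in S}|s-s'|$. Then for all $n\in\mathbb{N}$ and all integers $m>4n(3n+1)$, $$g\big[\mathbf{CP}_m(S)\big]\ \ge\ \frac{\operatorname{diam}(S)}{2\sup_{s\in S}|s|}\;g\big[\mathbf{CP}_n(\mathbb{R})\big].$$
   Context: For an $n\times n$ complex matrix $A=(a_{i,j})$, Gaussian elimination without pivoting is the recursion $a^{(1)}_{i,j}=a_{i,j}$ and $a^{(k+1)}_{i,j}=a^{(k)}_{i,j}-a^{(k)}_{i,k}a^{(k)}_{k,j}/a^{(k)}_{k,k}$ for $k+1\le i,j\le n$, $k=1,\dots,n-1$ (defined when all pivots are nonzero). Growth factor: $g(A)=\max_{i,j,k}|a^{(k)}_{i,j}|/\max_{i,j}|a_{i,j}|$; for a set $\mathbf{X}$ of matrices, $g[\mathbf{X}]=\sup_{A\in\mathbf{X}}g(A)$. For $S\subseteq\mathbb{C}$, $\mathbf{CP}_n(S)$ is the set of invertible $A\in S^{n\times n}$ (entries of the input matrix in $S$; intermediate iterates need not be in $S$) for which elimination is defined and $|a^{(k)}_{i,j}|\le|a^{(k)}_{k,k}|$ for all $k$ and all $i,j\ge k$. *)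

(* Defs.v *)
From mathcomp Require Import all_boot all_order all_algebra.
From mathcomp Require Import all_classical all_reals.
From mathcomp Require Import ereal.
Set Implicit Arguments. Unset Strict Implicit. Unset Printing Implicit Defensive.
Import Order.TTheory GRing.Theory Num.Theory.
Local Open Scope ring_scope.
Local Open Scope classical_set_scope.

Section GE.
Variable R : realType.

Definition ent n (A : 'M[R]_n) (i j : nat) : R :=
  match @insub nat (fun k => k < n)%N 'I_n i, @insub nat (fun k => k < n)%N 'I_n j with
  | Some i', Some j' => A i' j'
  | _, _ => 0
  end.

(* gea A k i j = a^{(k+1)}_{i+1,j+1} of the paper (0-based indices);
   stage k (0-based) is obtained from stage k-1 by eliminating with pivot
   index k-1, and only the entries with i,j >= k are modified/meaningful. *)
Fixpoint gea n (A : 'M[R]_n) (k i j : nat) : R :=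
  match k with
  | 0 => ent A i j
  | k'.+1 =>
      if ((k' < i) && (k' < j))%N then
        gea A k' i j - gea A k' i k' * gea A k' k' j / gea A k' k' k'
      else gea A k' i j
  end.

Definition ge_defined n (A : 'M[R]_n) : Prop :=
  forall k : nat, (k < n.-1)%N -> gea A k k k != 0.

Definition ge_maxiter n (A : 'M[R]_n) : R :=
  \big[Num.max/0]_(k < n) \big[Num.max/0]_(i < n | (k <= i)%N)
     \big[Num.max/0]_(j < n | (k <= j)%N) `|gea A k i j|.

Definition maxentry n (A : 'M[R]_n) : R :=
  \big[Num.max/0]_(i < n) \big[Num.max/0]_(j < n) `|A i j|.

Definition growth n (A : 'M[R]_n) : R := ge_maxiter A / maxentry A.

Definition CP n (S : set R) : set 'M[R]_n :=
  [set A : 'M[R]_n | [/\ (forall i j, S (A i j)),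
              A \in unitmx,
              ge_defined A &
              (forall k i j : nat, (k < n)%N -> (k <= i < n)%N -> (k <= j < n)%N ->
                  `|gea A k i j| <= `|gea A k k k|)]].

Definition gsup n (X : set 'M[R]_n) : \bar R :=
  ereal_sup [set (growth A)%:E | A in X].

Definition diam (S : set R) : R := sup [set `|s - s'| | s in S & s' in S].

Definition supabs (S : set R) : R := sup [set `|s| | s in S].

End GE.

Arguments CP {R} n S.

(* Main.v *)
(** Only the last pivot of a completely pivoted matrix matters, and it may be taken largest by truncating.
    Enlarging every pivot relative to its row and column leaves the Schur complements essentially unchanged and makes the matrix strictly completely pivoted, so that its entries, scaled into [-1, 1], can be rounded to a dyadic grid of mesh 2^-O(n).
    Dyadic entries are then produced by elimination itself: a pivot -2, obtained by eliminating a pivot 1 from entries of modulus at most 1, adds half of an auxiliary column to a given column, so two extra rows remove one binary digit from one column.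
    A pivot 1 per column removes the signs, and a first row and column constantly equal to p turn {0, 1} into {p, q} with a factor q - p.
    The rounding loses less than a factor 2 of growth. *)
Require Import Defs.
From mathcomp Require Import all_boot all_order all_algebra.
From mathcomp Require Import all_classical all_reals.
From mathcomp Require Import ereal.
From mathcomp Require Import zify ring lra.
Import Order.TTheory GRing.Theory Num.Theory.
Local Open Scope ring_scope.
Local Open Scope classical_set_scope.

(** * Complete pivoting as a recursion on Schur complements, and its stability under perturbation *)

Section Elimination.
Context {R : realType}.
Implicit Types (f g : nat -> nat -> R) (G : R) (n : nat).

Definition step f (i j : nat) : R :=
  f i.+1 j.+1 - f i.+1 0%N * f 0%N j.+1 / f 0%N 0%N.

(* Indices run over [0..n], so the matrix has order [n.+1]. *)
Fixpoint cpivot G n f : Prop :=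
  if n is n'.+1 then
    [/\ f 0%N 0%N != 0,
        (forall i j, (i <= n)%N -> (j <= n)%N -> `|f i j| <= `|f 0%N 0%N|) &
        cpivot G n' (step f)]
  else G <= `|f 0%N 0%N|.

(** An elimination step run backwards: a bordered matrix whose Schur complement is [f]. All
    constructions below are made of such borderings. *)
Definition prepend (p : R) (r c : nat -> R) f (i j : nat) : R :=
  match i, j with
  | 0, 0 => p
  | 0, j'.+1 => r j'
  | i'.+1, 0 => c i'
  | i'.+1, j'.+1 => f i' j' + c i' * r j' / p
  end.

Definition unitv (c j : nat) : R := (j == c)%:R.

Lemma step_prepend (p : R) (r c : nat -> R) f : step (prepend p r c f) = f.
Proof. by apply/funext=> i; apply/funext=> j; rewrite /step /= addrK. Qed.

Lemma eq_cpivot n G f g :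
  (forall i j, (i <= n)%N -> (j <= n)%N -> f i j = g i j) ->
  cpivot G n f -> cpivot G n g.
Proof.
elim: n f g => [|n IH] f g fg /=; first by rewrite fg.
move=> [p0 bnd cs]; split.
- by rewrite -fg.
- by move=> i j li lj; rewrite -!fg //; apply: bnd.
- apply: IH cs => i j li lj; rewrite /step !fg //; lia.
Qed.

Lemma cpivot_bound G n f i j : cpivot G n f -> (i <= n)%N -> (j <= n)%N ->
  `|f i j| <= `|f 0%N 0%N|.
Proof.
case: n => [_|n [_ b _]]; last exact: b.
by rewrite !leqn0 => /eqP-> /eqP->.
Qed.

(** Unrolls the recursion into iterated Schur complements, the form comparable with [gea]. *)
Lemma cpivotP G n f :
  cpivot G n f <->
  [/\ forall k, (k < n)%N -> iter k step f 0%N 0%N != 0,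
      forall k i j, (k + i <= n)%N -> (k + j <= n)%N ->
        `|iter k step f i j| <= `|iter k step f 0%N 0%N| &
      G <= `|iter n step f 0%N 0%N| ].
Proof.
elim: n f => [|n IH] f.
  split=> [Gf|[_ _]] //; split=> // k i j.
  rewrite !leqn0 !addn_eq0 => /andP[/eqP-> /eqP->] /andP[_ /eqP->] //.
rewrite iterSr; split=> [[p0 b /IH[h1 h2 h3]]|[h1 h2 h3]].
  split=> // [[|k] kn|[|k] i j ki kj] //; rewrite ?iterSr.
  - exact: h1.
  - exact: b.
  - exact: h2.
split; first exact: (h1 0%N).
  by move=> i j; apply: (h2 0%N).
apply/IH; split=> // [k kn|k i j ki kj]; rewrite -iterSr.
- exact: h1.
- exact: h2.
Qed.

Lemma cpivot_scale (a G : R) n f : a != 0 -> cpivot G n f ->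
  cpivot (`|a| * G) n (fun i j => a * f i j).
Proof.
move=> a0; elim: n f => [|n IH] f /=; first by rewrite normrM; apply: ler_wpM2l.
move=> [p0 b cs]; split; first by rewrite mulf_neq0.
  by move=> i j li lj; rewrite !normrM ler_wpM2l// b.
apply: eq_cpivot (IH _ cs) => i j _ _.
by rewrite /step; field; rewrite p0 a0.
Qed.

Lemma cpivot_prepend (p : R) (r c : nat -> R) G n f :
  p != 0 ->
  (forall i j, (i <= n.+1)%N -> (j <= n.+1)%N ->
     `|prepend p r c f i j| <= `|p|) ->
  cpivot G n f -> cpivot G n.+1 (prepend p r c f).
Proof. by move=> p0 b cf; split=> //; rewrite step_prepend. Qed.

(* Entrywise errors grow by a factor at most 4 per elimination step, since both multipliers are at most 1. *)
Lemma schur_error (t p p' c c' r r' x x' : R) :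
  p != 0 -> p' != 0 -> `|c'| <= `|p'| -> `|r| <= `|p| ->
  `|p' - p| <= t -> `|c' - c| <= t -> `|r' - r| <= t -> `|x' - x| <= t ->
  `|(x' - c' * r' / p') - (x - c * r / p)| <= 4 * t.
Proof.
move=> p0 p'0 cp rp ep ec er ex.
have t0 : 0 <= t by apply: le_trans ep.
have small (u v : R) : v != 0 -> `|u| <= `|v| -> `|u / v| <= 1.
  by move=> v0 uv; rewrite normrM normfV ler_pdivrMr ?mul1r ?normr_gt0.
have mt (u v : R) : `|u| <= 1 -> `|v| <= t -> `|u * v| <= t.
  by move=> u1 vt; rewrite normrM -[t]mul1r ler_pM.
have -> : x' - c' * r' / p' - (x - c * r / p) =
  (x' - x) - (c' / p') * (r' - r)
  - (r / p) * ((c' - c) - (c' / p') * (p' - p)) by field; rewrite p0 p'0.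
have h1 := mt _ _ (small _ _ p'0 cp) er.
have h2 := mt _ _ (small _ _ p'0 cp) ep.
have h3 := small _ _ p0 rp.
have h4 : `|(c' - c) - (c' / p') * (p' - p)| <= 2 * t.
  by rewrite (le_trans (ler_normB _ _))//; lra.
have h5 : `|(r / p) * ((c' - c) - (c' / p') * (p' - p))| <= 2 * t.
  by rewrite normrM -[2 * t]mul1r ler_pM.
apply: le_trans (ler_normB _ _) _; apply: le_trans (lerD (ler_normB _ _) h5) _.
lra.
Qed.

(* The pivot is enlarged by the factor q, its row and column by s' and s with s s' = q: the Schur complement does not change, while the pivot becomes strictly dominant. *)
Lemma cpivot_robust (tau : R) n G f : 0 < tau -> cpivot G n f ->
  exists2 f', (forall i j, (i <= n)%N -> (j <= n)%N ->
      `|f' i j - f i j| <= 4 / 3 * tau * (1 - 4^-1 ^+ n)) &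
    forall h, (forall i j, (i <= n)%N -> (j <= n)%N ->
        `|h i j - f' i j| <= tau * 4^-1 ^+ n) -> cpivot (G - tau) n h.
Proof.
move=> tau0; elim: n f => [|n IH] f.
  move=> Gf; exists f => [i j _ _|h hf]; first by rewrite subrr normr0 expr0; lra.
  have := hf 0%N 0%N isT isT; rewrite expr0 mulr1 /= => e.
  have := lerB_dist (f 0%N 0%N) (h 0%N 0%N); rewrite distrC => e'.
  move: Gf => /=; lra.
move=> [p0 bnd /IH [g' g'g Hg']].
set y := (4^-1 : R) ^+ n in g'g Hg' *.
have y0 : 0 < y by rewrite exprn_gt0// invr_gt0 ltr0n.
have y1 : y <= 1 by rewrite exprn_ile1// ?invr_ge0 ?ler0n// invf_le1 ?ltr0n ?ler1n.
have ty0 : 0 < tau * y by rewrite mulr_gt0.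
rewrite exprS -/y.
set p := f 0%N 0%N in p0 bnd.
set P := `|p|; have P0 : 0 < P by rewrite normr_gt0.
(* [eta] is the error inherited from the Schur complement; adding [tau * y] to it gives exactly the
   error allowed one order higher ([etaE]). *)
set eta := 4 / 3 * tau * (1 - y) in g'g.
have eta0 : 0 <= eta.
  by rewrite /eta mulr_ge0 ?subr_ge0//; lra.
set d := eta + tau * y.
(* This factor raises the modulus of the pivot from [P] to [P + d]. *)
set q := 1 + d / P.
have dE : d = (q - 1) * P by rewrite /q; field; rewrite gt_eqF.
have d0 : 0 < d by rewrite /d; lra.
have q1 : 1 < q by rewrite /q ltrDl divr_gt0.
(* Arithmetic and harmonic means of 1 and [q]: their product is [q], and both are at most [s], so
   the enlarged row and column stay below [P + d / 2]. *)
set s := (1 + q) / 2; set s' := 2 * q / (1 + q).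
have s's : s' <= s by rewrite /s /s' ler_pdivrMr; nra.
have s'1 : 1 <= s' by rewrite /s' ler_pdivlMr; lra.
have s1 : 1 <= s by lra.
have sP : s * P = P + d / 2 by rewrite dE /s; field.
have etaE : 4 / 3 * tau * (1 - 4^-1 * y) = d by rewrite /d /eta; field.
rewrite etaE.
pose f' := prepend (q * p) (fun j => s' * f 0%N j.+1) (fun i => s * f i.+1 0%N) g'.
have qp0 : q * p != 0 by rewrite mulf_neq0// gt_eqF//; lra.
have f'in i j : f' i.+1 j.+1 = g' i j + f i.+1 0%N * f 0%N j.+1 / p.
  by rewrite /f' /= /s /s'; field; rewrite p0 !gt_eqF//; lra.
have nq : `|q * p| = P + d.
  by rewrite normrM gtr0_norm ?dE; [rewrite -/P; ring|lra].
have scale_close (a x : R) : 1 <= a -> a <= s -> `|x| <= P -> `|a * x - x| <= d / 2.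
  move=> a1 as_ xP; have -> : a * x - x = (a - 1) * x by ring.
  rewrite normrM ger0_norm; last by lra.
  have : (a - 1) * `|x| <= (s - 1) * P by apply: ler_pM => //; lra.
  lra.
have close i j : (i <= n.+1)%N -> (j <= n.+1)%N -> `|f' i j - f i j| <= d.
  case: i => [|i] li; case: j => [|j] lj.
  - rewrite /f' /= -/p; have -> : q * p - p = (q - 1) * p by ring.
    by rewrite normrM gtr0_norm -/P; lra.
  - by rewrite /f' /= (le_trans (scale_close _ _ _ _ (bnd _ _ _ _)))//; lra.
  - by rewrite /f' /= (le_trans (scale_close _ _ _ _ (bnd _ _ _ _)))//; lra.
  - rewrite f'in; apply: (@le_trans _ _ eta); last by rewrite /d; lra.
    have -> : g' i j + f i.+1 0%N * f 0%N j.+1 / p - f i.+1 j.+1 = g' i j - step f i j.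
      by rewrite /step -/p; ring.
    exact: g'g.
(* The gap is twice the tolerance on [h]: one share absorbs the error of the entry, the other that
   of the pivot. *)
have dom i j : (i <= n.+1)%N -> (j <= n.+1)%N -> (i, j) != (0%N, 0%N) ->
    `|f' i j| + 2 * (tau * (4^-1 * y)) <= P + d.
  have E : 4 * (tau * (4^-1 * y)) = tau * y by field.
  have scaled (a x : R) : 1 <= a -> a <= s -> `|x| <= P ->
      `|a * x| + 2 * (tau * (4^-1 * y)) <= P + d.
    move=> a1 as_ xP; rewrite normrM ger0_norm; last by lra.
    have : a * `|x| <= s * P by apply: ler_pM => //; lra.
    move: ty0; rewrite /d in sP *; lra.
  case: i => [|i] li; case: j => [|j] lj //= _.
  - by apply: scaled => //; apply: bnd.
  - by apply: scaled => //; apply: bnd.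
  - have h := g'g i j li lj.
    have -> : g' i j + s * f i.+1 0%N * (s' * f 0%N j.+1) / (q * p) = f' i.+1 j.+1 by [].
    have -> : f' i.+1 j.+1 = (g' i j - step f i j) + f i.+1 j.+1.
      by rewrite f'in /step -/p; ring.
    have := ler_normD (g' i j - step f i j) (f i.+1 j.+1).
    have := bnd i.+1 j.+1 li lj; rewrite -/P /d; lra.
exists f' => // h hf'.
set t := tau * (4^-1 * y) in hf' dom.
have t0 : 0 < t by rewrite /t; lra.
have td : 4 * t <= d by rewrite /t /d; lra.
have h00 : P + d - t <= `|h 0%N 0%N|.
  have := hf' 0%N 0%N isT isT; rewrite distrC => e.
  have := lerB_dist (f' 0%N 0%N) (h 0%N 0%N); rewrite [f' 0%N 0%N]/f' /= nq.
  rewrite [f' 0%N 0%N]/f' /= in e; lra.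
have hb i j : (i <= n.+1)%N -> (j <= n.+1)%N -> `|h i j| <= `|h 0%N 0%N|.
  move=> li lj; have [[-> ->]//|ij] := eqVneq (i, j) (0%N, 0%N).
  have := dom i j li lj ij; have := hf' i j li lj.
  have := lerB_dist (h i j) (f' i j); lra.
have hp0 : h 0%N 0%N != 0 by rewrite -normr_gt0; lra.
split=> //; apply: Hg' => i j li lj.
(* The factor 4 of [schur_error] turns the tolerance into the one of the induction hypothesis. *)
have -> : tau * y = 4 * t by rewrite /t; field.
rewrite -(step_prepend (q * p) (fun j => s' * f 0%N j.+1) (fun i => s * f i.+1 0%N) g').
rewrite -/f' /step; apply: schur_error => //; try exact: hf'; try exact: hb.
have : (0%N, j.+1) != (0%N, 0%N) by [].
move=> /(dom 0%N j.+1 isT lj); rewrite [f' 0%N 0%N]/f' /= nq; lra.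
Qed.

End Elimination.

(** * Exact encodings by bordering: removing digits, removing signs, padding, two arbitrary
    values *)

Section Encoding.
Context {R : realType}.
Implicit Types (f g : nat -> nat -> R) (G : R) (n : nat).

(** The error 1/2 is what allows twice the remainder to serve as a column with entries in
    [-1, 1]. *)
Lemma nearest_sign (x : R) : `|x| <= 1 ->
  exists t, [/\ `|t| <= 1, t \is a Num.int & `|x - t| <= 1 / 2].
Proof.
rewrite ler_norml => /andP[x1 x2].
have [h|h] := ltP x (- (1 / 2)).
  exists (-1); rewrite normrN1 rpredN rpred1; split=> //.
  by rewrite ler_norml; apply/andP; split; lra.
have [h'|h'] := ltP (1 / 2) x.
  exists 1; rewrite normr1 rpred1; split=> //.
  by rewrite ler_norml; apply/andP; split; lra.
exists 0; rewrite normr0 rpred0 ler01 subr0; split=> //.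
by rewrite ler_norml; apply/andP; split; lra.
Qed.

(* One bit of column c is traded for two new rows and columns: eliminating the pivots 1 and then -2 adds u/2 to column c, where u is the column in position 1. *)
Lemma cpivot_unbit1 G n f (c k : nat) :
  (c <= n)%N -> cpivot G n f ->
  (forall i j, (i <= n)%N -> (j <= n)%N -> `|f i j| <= 1) ->
  (forall i, (i <= n)%N -> 2 ^+ k.+1 * f i c \is a Num.int) ->
  exists f', [/\ cpivot G n.+2 f',
    forall i j, (i <= n.+2)%N -> (j <= n.+2)%N -> `|f' i j| <= 1,
    forall i, (i <= n.+2)%N -> [/\ f' i 0%N \is a Num.int,
      2 ^+ k * f' i 1%N \is a Num.int & f' i c.+2 \is a Num.int] &
    forall i (j : nat), j != c -> f' i j.+2 = if i is i'.+2 then f i' j else 0].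
Proof.
move=> cn Gf f1 fc.
have /choice [t Ht] : forall i, exists t : R, (i <= n)%N ->
   [/\ `|t| <= 1, t \is a Num.int & `|f i c - t| <= 1 / 2].
  move=> i; case: (leqP i n) => [li|_]; last by exists 0.
  by have [t ?] := nearest_sign _ (f1 i c li cn); exists t.
(* Column [c] is t + u/2, and the doubling leaves [u] with [k] binary digits instead of [k.+1]. *)
pose u i := 2 * (f i c - t i).
have u1 i : (i <= n)%N -> `|u i| <= 1.
  by move=> /Ht[_ _ h]; rewrite normrM ger0_norm//; lra.
pose g1 := prepend (-2) (unitv c) u f.
have g1E i j : g1 i.+1 j.+1 = if j == c then t i else f i j.
  rewrite /g1 /= /unitv; case: eqVneq => [->|_] /=.
    by rewrite mulr1 /u; field.
  by rewrite mulr0 mul0r addr0.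
have e01 (a b : nat) : `|unitv a b : R| <= 1.
  by rewrite /unitv; case: eqP => _; rewrite ?normr1 ?normr0 ?ler01.
have g1b i j : (i <= n)%N -> (j <= n)%N -> `|g1 i.+1 j.+1| <= 1.
  move=> li lj; rewrite g1E; case: eqP => _; last exact: f1.
  by have [] := Ht i li.
have n2 : `|(-2) : R| = 2 by rewrite normrN ger0_norm.
have Gg1 : cpivot G n.+1 g1.
  apply: cpivot_prepend => //.
  move=> i j li lj; rewrite n2 -/g1.
  case: i li => [|i] li; case: j lj => [|j] lj.
  - by rewrite /g1 /= n2.
  - by rewrite /g1 /= (le_trans (e01 _ _))//; lra.
  - by rewrite /g1 /= (le_trans (u1 _ _))//; lra.
  - by rewrite (le_trans (g1b _ _ _ _))//; lra.
(* The pivot -2 exceeds 1 in modulus; this border adds 1 to it and changes no other entry of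
   [g1]. *)
pose g2 := prepend 1 (unitv 0) (unitv 0) g1.
have g2E i j : g2 i.+1 j.+1 = match i, j with
    | 0, 0 => -1 | 0, j'.+1 => unitv c j' | i'.+1, 0 => u i' | _, _ => g1 i j end.
  rewrite /g2 /= /unitv divr1.
  case: i => [|i]; case: j => [|j] //=; rewrite ?mulr0 ?mul0r ?addr0 //=.
  by rewrite mulr1 /g1 /=; ring.
have g2b i j : (i <= n.+2)%N -> (j <= n.+2)%N -> `|g2 i j| <= 1.
  case: i => [|i] li; case: j => [|j] lj; rewrite ?g2E; try by rewrite /g2 /= ?normr1.
  case: i li => [|i] li; case: j lj => [|j] lj //; rewrite ?normrN1 //.
  - exact: u1.
  - exact: g1b.
have eint (a b : nat) : (unitv a b : R) \is a Num.int by rewrite /unitv rpred_nat.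
exists g2; split=> //.
- by apply: cpivot_prepend => // i j li lj; rewrite normr1 g2b.
- move=> [|[|i]] li; split; rewrite ?g2E ?g1E ?eqxx.
  + exact: rpred1.
  + by rewrite /g2 /=; rewrite rpredM ?rpredX ?rpred_nat.
  + exact: eint.
  + exact: eint.
  + by rewrite mulrN1 rpredN rpredX ?rpred_nat.
  + exact: eint.
  + exact: eint.
  + have [_ ti _] := Ht i li.
    have -> : 2 ^+ k * u i = 2 ^+ k.+1 * f i c - 2 ^+ k.+1 * t i.
      by rewrite /u exprS; ring.
    by rewrite rpredB ?fc// rpredM ?rpredX ?rpred_nat.
  + by have [_ ti _] := Ht i li.
- move=> i j jc; case: i => [|[|i]].
  + by [].
  + by rewrite g2E /unitv (negbTE jc).
  + by rewrite g2E g1E (negbTE jc).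
Qed.

(** Induction on the total number [w] of binary digits, where [b] counts them column by column. *)
Lemma cpivot_unbit w G n f (b : nat -> nat) :
  cpivot G n f ->
  (forall i j, (i <= n)%N -> (j <= n)%N -> `|f i j| <= 1) ->
  (forall i j, (i <= n)%N -> (j <= n)%N -> 2 ^+ b j * f i j \is a Num.int) ->
  (\sum_(j < n.+1) b j = w)%N ->
  exists2 f', cpivot G (n + 2 * w) f' &
    forall i j, (i <= n + 2 * w)%N -> (j <= n + 2 * w)%N ->
      `|f' i j| <= 1 /\ f' i j \is a Num.int.
Proof.
elim: w n f b => [|w IH] n f b Gf f1 fb bw.
  exists f; first by rewrite addn0.
  rewrite addn0 => i j li lj; split; first exact: f1.
  have := fb i j li lj; suff -> : b j = 0%N by rewrite expr0 mul1r.
  move/eqP: bw; rewrite sum_nat_eq0 => /forallP/(_ (inord j)).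
  by rewrite /= inordK ?ltnS// => /eqP.
have [c bc] : exists c : 'I_n.+1, b c != 0%N.
  apply/existsP; rewrite -[X in is_true X]negbK negb_exists; apply/negP => /forallP H.
  by move: bw; rewrite big1 // => i _; move: (H i); rewrite negbK => /eqP.
have cn : (c <= n)%N by rewrite -ltnS.
case E: (b c) bc => [//|k] _.
have [f' [Gf' f'1 f'c f'o]] := cpivot_unbit1 G n f c k cn Gf f1
  (fun i li => ltac:(by move: (fb i c li cn); rewrite E)).
(* Column [c] loses its [k.+1] digits, the auxiliary column 1 carries [k], and the others keep
   theirs: the total drops by exactly one. *)
pose b' j := match j with 0 => 0%N | 1 => k | j'.+2 => if j' == c then 0%N else b j' end.
have -> : (n + 2 * w.+1 = n.+2 + 2 * w)%N by lia.
apply: (IH _ f' b') => //.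
- move=> i j li; have [h0 h1 h2] := f'c i li.
  case: j => [|[|j]] lj; rewrite /b' ?expr0 ?mul1r //.
  case: eqVneq => [->|jc]; first by rewrite expr0 mul1r.
  rewrite f'o //; case: i li {h0 h1 h2} => [|[|i]] li; rewrite ?mulr0 ?rpred0 //.
  exact: fb.
- have := bw; rewrite (bigD1 c) //= E addSn => /succn_inj <-.
  rewrite 2!big_ord_recl [in X in (_ + (_ + X))%N = _](bigD1 c) //=.
  rewrite !add0n eqxx add0n; congr addn.
  apply: eq_bigr => i ic; rewrite add0n.
  by case: eqVneq => // /val_inj h; rewrite h eqxx in ic.
Qed.

(* The sign of column c is split off as one rank-one update by a pivot 1. *)
Lemma cpivot_unsign r G n f (a : nat) : (a + r = n.+1)%N ->
  cpivot G n f ->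
  (forall i j, (i <= n)%N -> (j <= n)%N -> [\/ f i j = 0, f i j = 1 | f i j = -1]) ->
  (forall i j, (i <= n)%N -> (j < a)%N -> f i j = 0 \/ f i j = 1) ->
  exists2 f', cpivot G (n + r) f' &
    forall i j, (i <= n + r)%N -> (j <= n + r)%N -> f' i j = 0 \/ f' i j = 1.
Proof.
elim: r n f a => [|r IH] n f a.
  by rewrite addn0 => -> Gf _ f01; exists f; rewrite addn0.
move=> arn Gf fs f01; have an : (a <= n)%N by lia.
pose u i : R := (f i a == -1)%:R.
pose g := prepend 1 (unitv a) u f.
have gE i j : g i.+1 j.+1 = if j == a then f i j + u i else f i j.
  rewrite /g /= /unitv; case: eqP => _; rewrite divr1 ?mulr1 ?mulr0 ?addr0//.
have m11 : (-1 : R) == 1 = false by rewrite lt_eqF//; lra.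
have ga i : (i <= n)%N -> f i a + u i = 0 \/ f i a + u i = 1.
  move=> li; rewrite /u; case: (fs i a li an) => -> ; rewrite ?eqxx.
  - by left; rewrite eq_sym oppr_eq0 oner_eq0 addr0.
  - by right; rewrite eq_sym m11 addr0.
  - by left; rewrite addNr.
have gs i j : (i <= n.+1)%N -> (j <= n.+1)%N -> [\/ g i j = 0, g i j = 1 | g i j = -1].
  have nb (b : bool) : [\/ b%:R = 0 :> R, b%:R = 1 :> R | b%:R = -1 :> R].
    by case: b; [constructor 2|constructor 1].
  case: i => [|i] li; case: j => [|j] lj; rewrite ?gE; try exact: nb.
    by constructor 2.
  case: eqP => [->|_]; last exact: fs.
  by case: (ga i li) => ->; [constructor 1|constructor 2].
have -> : (n + r.+1 = n.+1 + r)%N by lia.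
(* The [a] clean columns are shifted by one; the new column 0 and the old column [a] join them. *)
apply: (IH n.+1 g a.+2) => //; first by lia.
- apply: cpivot_prepend => //.
  by move=> i j li lj; rewrite -/g; case: (gs i j li lj) => ->; rewrite ?normrN normr1 ?normr0 ?ler01.
- have nb (b : bool) : b%:R = 0 :> R \/ b%:R = 1 :> R by case: b; [right|left].
  case=> [|i] [|j] li lj; rewrite ?gE; try exact: nb; first by right.
  case: eqP => [->|ja]; first exact: ga.
  apply: f01 => //; lia.
Qed.

(** A direct sum with an identity block, built one row at a time, reaches any larger order. *)
Lemma cpivot_pad k G n f : cpivot G n f ->
  (forall i j, (i <= n)%N -> (j <= n)%N -> f i j = 0 \/ f i j = 1) ->
  exists2 f', cpivot G (n + k) f' &
    forall i j, (i <= n + k)%N -> (j <= n + k)%N -> f' i j = 0 \/ f' i j = 1.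
Proof.
move=> Gf f01; elim: k => [|k [g Gg g01]]; first by exists f; rewrite addn0.
rewrite addnS.
pose g' := prepend 1 (fun=> 0) (fun=> 0) g.
have g'01 i j : (i <= (n + k).+1)%N -> (j <= (n + k).+1)%N -> g' i j = 0 \/ g' i j = 1.
  case: i => [|i] li; case: j => [|j] lj; [by right|by left|by left|].
  by rewrite /g' /= !mul0r addr0; apply: g01.
exists g' => //; apply: cpivot_prepend => // i j li lj.
by case: (g'01 i j li lj) => E; rewrite -/g' E normr1 ?normr0 ?ler01.
Qed.

(** The border is filled with the value of larger modulus, since it supplies the first pivot;
    eliminating it leaves [q - p] times the 0-1 matrix. *)
Lemma cpivot_two_values (p q : R) G n f : p != q -> `|q| <= `|p| -> cpivot G n f ->
  (forall i j, (i <= n)%N -> (j <= n)%N -> f i j = 0 \/ f i j = 1) ->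
  exists2 f', cpivot (`|q - p| * G) n.+1 f' &
    forall i j, (i <= n.+1)%N -> (j <= n.+1)%N -> f' i j = p \/ f' i j = q.
Proof.
move=> pq qp Gf f01.
have p0 : p != 0.
  by apply: contra_neq pq => p0; move: qp; rewrite p0 normr0 normr_le0 => /eqP.
pose g := prepend p (fun=> p) (fun=> p) (fun i j => (q - p) * f i j).
have gpq i j : (i <= n.+1)%N -> (j <= n.+1)%N -> g i j = p \/ g i j = q.
  case: i => [|i] li; case: j => [|j] lj; [by left|by left|by left|].
  rewrite /g /= mulfK//; case: (f01 i j li lj) => ->; [left|right]; ring.
exists g => //; apply: cpivot_prepend => //.
  by move=> i j li lj; case: (gpq i j li lj) => E; rewrite -/g E.
by apply: cpivot_scale => //; rewrite subr_eq0 eq_sym.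
Qed.

End Encoding.

(** * Dyadic rounding, assembly of the encodings, and translation between [cpivot] and [CP] *)

Section Conversion.
Context {R : realType}.
Implicit Types (f g : nat -> nat -> R) (G : R) (n : nat).

Lemma cpivot_le G G' n f : G' <= G -> cpivot G n f -> cpivot G' n f.
Proof.
by move=> GG /cpivotP[h1 h2 h3]; apply/cpivotP; split=> //; apply: le_trans h3.
Qed.

Lemma cpivot_gt0 G n f : 0 < G -> cpivot G n f -> 0 < `|f 0%N 0%N|.
Proof.
by case: n => [|n] G0; [exact: lt_le_trans|case; rewrite normr_gt0].
Qed.

Lemma dyadic_rounding (K : nat) (x : R) : `|x| <= 1 ->
  exists y, [/\ `|y| <= 1, 2 ^+ K * y \is a Num.int & `|y - x| <= 2 ^- K].
Proof.
rewrite ler_norml => /andP[x1 x2].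
have e0 : 0 < 2 ^+ K :> R by rewrite exprn_gt0.
have fl := floor_le_tmp (2 ^+ K * x); have fg := floorD1_gt (2 ^+ K * x).
(* Since -1 is a grid point, rounding down does not leave [-1, 1]. *)
have fm : - 2 ^+ K <= (Num.floor (2 ^+ K * x))%:~R :> R.
  have -> : - 2 ^+ K = (- 2 ^+ K : int)%:~R :> R.
    by rewrite rmorphN rmorphXn.
  rewrite ler_int floor_ge_int_tmp rmorphN rmorphXn /=; nra.
exists ((Num.floor (2 ^+ K * x))%:~R / 2 ^+ K); split.
- rewrite ler_norml ler_pdivlMr// ler_pdivrMr//; apply/andP; split; nra.
- by rewrite mulrC divfK ?gt_eqF// intr_int.
- have -> : (Num.floor (2 ^+ K * x))%:~R / 2 ^+ K - x =
      ((Num.floor (2 ^+ K * x))%:~R - 2 ^+ K * x) * 2 ^- K.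
    by field; rewrite gt_eqF.
  rewrite normrM [X in _ * X]gtr0_norm ?invr_gt0// ler_piMl ?invr_ge0 ?ltW//.
  rewrite ltr_norml; move: fg; rewrite intrD; move=> fg; apply/andP; split; lra.
Qed.

Lemma cpivot_dyadic G n f : 0 < `|f 0%N 0%N| <= G -> cpivot G n f ->
  exists f', [/\ cpivot (G / (2 * `|f 0%N 0%N|)) n f',
    forall i j, (i <= n)%N -> (j <= n)%N -> `|f' i j| <= 1 &
    forall i j, (i <= n)%N -> (j <= n)%N -> 2 ^+ (2 * n + 3) * f' i j \is a Num.int].
Proof.
set P := `|f 0%N 0%N| => /andP[P0 PG] Gf.
have P40 : 0 < P / 4 by lra.
(* With [tau] equal to P/4, the entries of [g] are at most 4P/3, and G - P/4 is at least 3G/4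
   because P <= G. *)
have [g gf Hg] := cpivot_robust (P / 4) n G f P40 Gf.
have y0 : 0 < (4^-1 : R) ^+ n by rewrite exprn_gt0// invr_gt0 ltr0n.
set y := (4^-1 : R) ^+ n in gf Hg y0.
(* This scales 4P/3 to 1 and leaves a last pivot of at least 9/16 of G/P, more than the half that is
   claimed. *)
set l := 3 / (4 * P).
have l0 : 0 < l by rewrite divr_gt0//; lra.
have lP : l * P = 3 / 4 by rewrite /l; field; rewrite gt_eqF.
have x1 i j : (i <= n)%N -> (j <= n)%N -> `|l * g i j| <= 1.
  move=> li lj; rewrite normrM gtr0_norm//.
  have h1 := gf i j li lj; have h2 := cpivot_bound _ _ _ _ _ Gf li lj.
  have h3 := lerB_dist (g i j) (f i j).
  have : `|g i j| <= 4 / 3 * P by rewrite -/P in h2; nra.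
  nra.
have /choice [h Hh] : forall ij : nat * nat, exists z : R, (ij.1 <= n)%N && (ij.2 <= n)%N ->
    [/\ `|z| <= 1, 2 ^+ (2 * n + 3) * z \is a Num.int &
      `|z - l * g ij.1 ij.2| <= 2 ^- (2 * n + 3)].
  move=> [i j] /=; case: (boolP (_ && _)) => [/andP[li lj]|_]; last by exists 0.
  by have [z ?] := dyadic_rounding (2 * n + 3) _ (x1 i j li lj); exists z.
exists (fun i j => h (i, j)); split=> [|i j li lj|i j li lj]; last 2 first.
- by have [] := Hh (i, j); rewrite ?li.
- by have [] := Hh (i, j); rewrite ?li.
(* After scaling, the tolerance is 3/16 of [y]; the mesh [y / 8] lies below it, whence the exponent
   2n + 3. *)
have e2 : 2 ^- (2 * n + 3) = y / 8 :> R.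
  have -> : y = 2 ^- (2 * n) by rewrite /y exprVn exprM; congr ((_ ^+ n)^-1); ring.
  by rewrite exprD invfM; congr (_ * _^-1); ring.
have /(cpivot_scale l _ _ _ (lt0r_neq0 l0)) : cpivot (G - P / 4) n (fun i j => l^-1 * h (i, j)).
  apply: Hg => i j li lj; have [|_ _] := Hh (i, j); first by rewrite li.
  rewrite e2 /= => hh.
  have -> : l^-1 * h (i, j) - g i j = l^-1 * (h (i, j) - l * g i j).
    by field; rewrite gt_eqF.
  rewrite normrM gtr0_norm ?invr_gt0// ler_pdivrMl//.
  apply: le_trans hh _; rewrite mulrA mulrA lP; nra.
move=> Gl; have : cpivot (G / (2 * P)) n (fun i j => l * (l^-1 * h (i, j))).
  apply: cpivot_le Gl; rewrite gtr0_norm//.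
  have -> : G / (2 * P) = 2 / 3 * (l * G) by rewrite /l; field; rewrite gt_eqF.
  have : l * P <= l * G by rewrite ler_pM2l.
  nra.
by apply: eq_cpivot => i j _ _; rewrite mulVKf ?gt_eqF.
Qed.

(** There are [n.+1] columns of 2n + 3 digits, so removing digits reaches index M = n +
    2(n+1)(2n+3); removing the signs of [M.+1] columns reaches 2M + 1, and padding does the rest. *)
Lemma cpivot_zero_one G n N f : 0 < `|f 0%N 0%N| <= G -> cpivot G n f ->
  (2 * (n + 2 * (n.+1 * (2 * n + 3))) < N)%N ->
  exists2 f', cpivot (G / (2 * `|f 0%N 0%N|)) N f' &
    forall i j, (i <= N)%N -> (j <= N)%N -> f' i j = 0 \/ f' i j = 1.
Proof.
move=> PG Gf; have [f1 [Gf1 f11 f1K]] := cpivot_dyadic G n f PG Gf.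
have [|f2 Gf2 Hf2] := cpivot_unbit (n.+1 * (2 * n + 3)) _ _ _ (fun=> 2 * n + 3)%N Gf1 f11 f1K.
  by rewrite sum_nat_const card_ord.
set M := (n + _)%N in Gf2 Hf2 * => MN.
have f2s i j : (i <= M)%N -> (j <= M)%N -> [\/ f2 i j = 0, f2 i j = 1 | f2 i j = -1].
  move=> li lj; have [h /intrP[z zE]] := Hf2 i j li lj; move: h; rewrite zE.
  rewrite -intr_norm -[1]/(1%:~R) ler_int => z1.
  have [->|[->|->]] : z = 0 \/ z = 1 \/ z = -1 by lia.
  - by constructor 1.
  - by constructor 2.
  - by constructor 3.
have [f3 Gf3 Hf3] := cpivot_unsign M.+1 _ _ _ 0%N erefl Gf2 f2s (fun _ _ _ => ltac:(by [])).
have -> : N = (M + M.+1 + (N - (M + M.+1)))%N by lia.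
exact: cpivot_pad _ _ _ _ Gf3 Hf3.
Qed.

(** The tail of a left kernel vector lies in the left kernel of the Schur complement, so it vanishes
    by induction; the nonzero pivot then kills the head. The last pivot is nonzero because
    [0 < G]. *)
Lemma cpivot_left_kernel G n f (x : nat -> R) : 0 < G -> cpivot G n f ->
  (forall j, (j <= n)%N -> \sum_(i < n.+1) x i * f i j = 0) ->
  forall i, (i <= n)%N -> x i = 0.
Proof.
move=> G0; elim: n f x => [|n IH] f x.
  move=> /= Gf /(_ 0%N isT); rewrite big_ord1 => /eqP; rewrite mulf_eq0.
  case/orP=> /eqP h [|//] _ //; move: Gf; rewrite h normr0; lra.
move=> [p0 _ Gs] H.
have xS i : (i <= n)%N -> x i.+1 = 0.
  apply: (IH _ (fun i => x i.+1) Gs) => j lj.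
  have := H j.+1 lj; rewrite big_ord_recl => hj.
  have := H 0%N isT; rewrite big_ord_recl => h0.
  pose a := \sum_(i < n.+1) x i.+1 * f i.+1 0%N.
  pose b := \sum_(i < n.+1) x i.+1 * f i.+1 j.+1.
  have -> : \sum_(i < n.+1) x i.+1 * step f i j = b - a * (f 0%N j.+1 / f 0%N 0%N).
    rewrite /a /b mulr_suml -sumrB; apply: eq_bigr => k _; rewrite /step; ring.
  have <- : - (x 0%N * f 0%N 0%N) = a by exact: addr0_eq h0.
  have <- : - (x 0%N * f 0%N j.+1) = b by exact: addr0_eq hj.
  by field.
have x0 : x 0%N = 0.
  have := H 0%N isT; rewrite big_ord_recl big1 ?addr0; last first.
    by move=> i _; rewrite xS ?mul0r// -ltnS.
  by move=> /eqP; rewrite mulf_eq0 (negbTE p0) orbF => /eqP.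
by case=> [|i] li; [exact: x0|exact: xS].
Qed.

Lemma cpivot_unitmx G n f : 0 < G -> cpivot G n f ->
  (\matrix_(i < n.+1, j < n.+1) f i j) \in unitmx.
Proof.
move=> G0 Gf; rewrite -row_free_unit; apply/inj_row_free => v v0.
have H := @cpivot_left_kernel G n f (fun i => v 0 (inord i)) G0 Gf.
apply/rowP => i; rewrite mxE -[i in LHS]inord_val; apply: H; last by rewrite -ltnS.
move=> j lj; have /rowP/(_ (inord j)) := v0; rewrite !mxE => vj.
rewrite -[RHS]vj.
by apply: eq_bigr => k _; rewrite mxE inordK// inord_val.
Qed.

Lemma ent_ord n (A : 'M[R]_n) (i j : 'I_n) : ent A i j = A i j.
Proof. by rewrite /ent !valK. Qed.

(** [gea] keeps the original indices, whereas each [step] shifts them back to 0. *)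
Lemma gea_step n (A : 'M[R]_n) k i j :
  gea A k (k + i) (k + j) = iter k step (ent A) i j.
Proof.
elim: k i j => [|k IH] i j //=.
rewrite !addSn !ltnS !leq_addr /= /step -!IH !addn0.
by rewrite !addnS.
Qed.

Lemma maxentry_ge n (A : 'M[R]_n.+1) : `|ent A 0 0| <= maxentry A.
Proof.
rewrite (@ent_ord n.+1 A ord0 ord0) /maxentry.
apply: le_trans (le_bigmax _ _ ord0).
exact: (le_bigmax _ (fun j => `|A ord0 j|) ord0).
Qed.

Lemma growth_ge0 n (A : 'M[R]_n) : 0 <= growth A.
Proof. by rewrite divr_ge0//; apply: bigmax_ge_id. Qed.

(** The leading submatrix ending at the largest pivot has the same pivots up to there. Complete
    pivoting bounds every iterate by a pivot, hence by [G]. *)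
Lemma CP_cpivot n (A : 'M[R]_n.+1) : CP n.+1 [set: R] A ->
  exists k G, [/\ (k <= n)%N, 0 < `|ent A 0 0| <= G, cpivot G k (ent A) &
    growth A <= G / `|ent A 0 0|].
Proof.
move=> [_ Au Adef Acp].
have D k : gea A k k k = iter k step (ent A) 0%N 0%N.
  by rewrite -gea_step addn0.
have cp k i j : (k + i <= n)%N -> (k + j <= n)%N ->
    `|iter k step (ent A) i j| <= `|iter k step (ent A) 0%N 0%N|.
  by move=> ki kj; rewrite -gea_step -D; apply: Acp; lia.
have a0 : ent A 0 0 != 0.
  (* For order 1, [ge_defined] is vacuous and the pivot is nonzero by invertibility. *)
  case: n A Au Adef {Acp D cp} => [|n] A Au Adef; last exact: (Adef 0%N).
  move: Au; rewrite unitmxE det_mx11 unitfE.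
  by rewrite -[A _ _]ent_ord.
pose k0 : 'I_n.+1 := [arg max_(k > ord0) `|iter k step (ent A) 0%N 0%N|]%O.
have k0max (k : 'I_n.+1) : `|iter k step (ent A) 0%N 0%N| <= `|iter k0 step (ent A) 0%N 0%N|.
  by rewrite /k0; case: arg_maxP => //= i _; apply.
have k0n : (k0 <= n)%N by rewrite -ltnS.
exists k0, `|iter k0 step (ent A) 0%N 0%N|; split=> //.
- by rewrite normr_gt0 a0; exact: (k0max ord0).
- apply/cpivotP; split=> // [k kk|k i j ki kj]; last by apply: cp; lia.
  by rewrite -D; apply: Adef; rewrite /=; lia.
- have mx := maxentry_ge _ A.
  have mx0 : 0 < `|ent A 0 0| by rewrite normr_gt0.
  rewrite /growth ler_pM ?invr_ge0//.
  + by rewrite /ge_maxiter; apply: bigmax_ge_id.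
  + exact: le_trans mx.
  + rewrite /ge_maxiter.
    apply: bigmax_le => // k _; apply: bigmax_le => // i ki; apply: bigmax_le => // j kj.
    apply: le_trans (k0max k); rewrite -D; apply: Acp => //.
    * by rewrite ki ltn_ord.
    * by rewrite kj ltn_ord.
  + by rewrite lef_pV2 ?posrE//; apply: lt_le_trans mx.
Qed.

Lemma cpivot_CP (S : set R) (M : R) G n f : 0 < G -> 0 < M -> cpivot G n f ->
  (forall i j, (i <= n)%N -> (j <= n)%N -> S (f i j) /\ `|f i j| <= M) ->
  exists2 A, CP n.+1 S A & G / M <= growth A.
Proof.
move=> G0 M0 Gf fS.
set A := \matrix_(i < n.+1, j < n.+1) f i j.
have entE i j : (i <= n)%N -> (j <= n)%N -> ent A i j = f i j.
  move=> li lj; rewrite -[i]/(nat_of_ord (@Ordinal n.+1 i li)).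
  by rewrite -[j in LHS]/(nat_of_ord (@Ordinal n.+1 j lj)) ent_ord mxE.
have GA : cpivot G n (ent A) by apply: eq_cpivot Gf => i j li lj; rewrite entE.
have /cpivotP[h1 h2 h3] := GA.
have D k : gea A k k k = iter k step (ent A) 0%N 0%N by rewrite -gea_step addn0.
have e0 := cpivot_gt0 _ _ _ G0 GA.
exists A; first split.
- by move=> i j; rewrite mxE; have [] := fS i j (leq_ord i) (leq_ord j).
- exact: (@cpivot_unitmx G).
- by move=> k kn; rewrite D h1.
- move=> k i j kn /andP[ki li] /andP[kj lj]; rewrite D.
  by rewrite -(subnKC ki) -(subnKC kj) gea_step h2 ?subnKC.
- apply: ler_pM; rewrite ?invr_ge0 ?(ltW G0) ?(ltW M0)//.
  + apply: le_trans h3 _; rewrite -D.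
    apply: le_trans (le_bigmax _ _ ord_max).
    apply: le_trans (le_bigmax_cond _ _ (j := ord_max) _) => //.
    exact: (le_bigmax_cond _ (fun j : 'I_n.+1 => `|gea A n n j|) (j := ord_max)).
  + have mx := maxentry_ge n A.
    rewrite lef_pV2 ?posrE//; last exact: lt_le_trans mx.
    apply: bigmax_le => [|i _]; first exact: ltW.
    apply: bigmax_le => [|j _]; first exact: ltW.
    by rewrite mxE; have [] := fS i j (leq_ord i) (leq_ord j).
Qed.

Lemma growth_transfer (S : set R) (s s' M : R) (n m : nat) (A : 'M[R]_n) :
  (0 < n)%N -> (4 * n * (3 * n + 1) < m)%N ->
  (forall x, S x -> `|x| <= M) -> S s -> S s' -> s != s' -> CP n [set: R] A ->
  exists2 B, CP m S B & `|s - s'| / (2 * M) * growth A <= growth B.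
Proof.
move=> n0 nm SM.
wlog le_s : s s' / `|s'| <= `|s|.
  move=> W Ss Ss' ss' CA; have [h|h] := leP `|s'| `|s|; first exact: (W s s').
  by rewrite distrC; apply: (W s' s) => //; [exact: ltW|rewrite eq_sym].
move=> Ss Ss' ss'.
case: n A n0 nm => // n A _ nm /CP_cpivot[k [G [kn PG GA gA]]].
have P0 : 0 < `|ent A 0 0| by case/andP: PG.
have G0 : 0 < G by case/andP: PG => h1 h2; apply: lt_le_trans h2.
(* Index [m] means order [m.+1], and passing to two values adds one more row: the target order is
   [m.+2]. *)
case: m nm => [|[|m]] nm; [lia|lia|].
(* The lemma requires 8k^2 + 22k + 12 < m; the hypothesis gives 12n^2 + 28n + 14 < m, and k <= n. *)
have [|f Gf f01] := cpivot_zero_one G k m _ PG GA; first by nia.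
have [g Gg gss] := cpivot_two_values s s' _ _ _ ss' le_s Gf f01.
have d0 : 0 < `|s' - s| by rewrite normr_gt0 subr_eq0 eq_sym.
have M0 : 0 < M.
  apply: lt_le_trans (SM s Ss); rewrite normr_gt0; apply: contra_neq ss' => s0.
  by move: le_s; rewrite s0 normr0 normr_le0 => /eqP.
have GM0 : 0 < `|s' - s| * (G / (2 * `|ent A 0 0|)).
  by rewrite mulr_gt0// divr_gt0// mulr_gt0.
have [|B CB gB] := cpivot_CP S M _ _ _ GM0 M0 Gg.
  by move=> i j li lj; case: (gss i j li lj) => ->; split=> //; apply: SM.
exists B => //; apply: le_trans gB.
have -> : `|s' - s| * (G / (2 * `|ent A 0 0|)) / M =
    `|s - s'| / (2 * M) * (G / `|ent A 0 0|).
  by rewrite distrC; field; rewrite !gt_eqF.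
by rewrite ler_wpM2l// divr_ge0// mulr_ge0// ltW.
Qed.

End Conversion.

(** * Passage to suprema over matrices and over pairs in [S] *)

Theorem mainTheorem7 (R : realType) (S : set R)
  (hbounded : exists M : R, forall s, S s -> `|s| <= M)
  (htwo : exists s s' : R, [/\ S s, S s' & s != s'])
  (n m : nat) (hn : (0 < n)%N) (hm : (4 * n * (3 * n + 1) < m)%N) :
  ((diam S / (2 * supabs S))%:E * gsup (CP n [set: R]) <= gsup (CP m S))%E.
Proof.
have [M SM] := hbounded; have [s1 [s2 [Ss1 Ss2 s12]]] := htwo.
have Sle s : S s -> `|s| <= supabs S.
  move=> Ss; apply: ub_le_sup; last by exists s.
  by exists M => _ [x Sx <-]; apply: SM.
have dle s s' : S s -> S s' -> `|s - s'| <= diam S.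
  move=> Ss Ss'; apply: ub_le_sup; last by exists s => //; exists s'.
  exists (M + M) => _ [x Sx [y Sy <-]].
  by rewrite (le_trans (ler_normB _ _))// lerD// SM.
have d0 : 0 < diam S by apply: lt_le_trans (dle _ _ Ss1 Ss2); rewrite normr_gt0 subr_eq0.
have b0 : 0 < supabs S.
  have [h|h] := eqVneq s1 0.
    by apply: lt_le_trans (Sle _ Ss2); rewrite normr_gt0 -h eq_sym.
  by apply: lt_le_trans (Sle _ Ss1); rewrite normr_gt0.
have c0 : 0 < diam S / (2 * supabs S) by rewrite divr_gt0// mulr_gt0.
(* The diameter need not be attained, so the bound is proved for each pair and the supremum over
   pairs is taken last. *)
have key A s s' : CP n [set: R] A -> S s -> S s' -> s != s' ->
    ((`|s - s'| / (2 * supabs S) * growth A)%:E <= gsup (CP m S))%E.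
  move=> CA Ss Ss' ss'.
  have [B CB gB] := growth_transfer _ _ _ _ _ _ A hn hm Sle Ss Ss' ss' CA.
  apply: (@le_trans _ _ (growth B)%:E); first by rewrite lee_fin.
  by apply: ereal_sup_ubound; exists B.
rewrite -lee_pdivlMl//; apply: ge_ereal_sup => _ [A CA <-].
rewrite lee_pdivlMl// -EFinM.
move: (key A) => {}key; case: (gsup _) key => [r| |] key.
- rewrite lee_fin.
  (* Zero growth is split off so that dividing by it isolates [diam S]. *)
  have [g0|g0] := eqVneq (growth A) 0.
    by have := key _ _ CA Ss1 Ss2 s12; rewrite g0 !mulr0.
  have {}g0 : 0 < growth A by rewrite lt_neqAle eq_sym g0 growth_ge0.
  rewrite -ler_pdivlMr// ler_pdivrMr ?mulr_gt0//.
  apply: ge_sup; first by exists `|s1 - s2|; exists s1 => //; exists s2.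
  move=> _ [s Ss [s' Ss' <-]].
  rewrite -ler_pdivrMr ?mulr_gt0// ler_pdivlMr// -lee_fin.
  (* A pair of equal elements contributes 0, and [gsup] is nonnegative by the pair [s1], [s2]. *)
  have [->|ss'] := eqVneq s s'; last exact: key.
  rewrite subrr normr0 !mul0r lee_fin.
  have := key _ _ CA Ss1 Ss2 s12; rewrite lee_fin; apply: le_trans.
  by rewrite mulr_ge0 ?growth_ge0// divr_ge0// mulr_ge0// ltW.
- by rewrite leey.
- by have := key _ _ CA Ss1 Ss2 s12.
Qed.
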